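(* Let $\sigma\ge0$, let $F:[0,1]^n\to\mathbb{R}_{\ge0}$ be a monotone one-sided $\sigma$-smooth function, let $\alpha\in[0,1)$, and let $P\subseteq[0,1]^n$ be a polytime separable, downward-closed polytope. Let $x(t)$, $t\in[0,1]$, be the trajectory of the jump-start continuous greedy process with parameter $\alpha$. Then $x(1)\in P$ and \[ F(x(1))\ge\Big[1-\exp\Big(-(1-\alpha)\big(\tfrac{\alpha}{\alpha+1}\big)^{2\sigma}\Big)\Big]\cdot OPT, \] where $OPT=\max\{F(x):x\in P\}$.
   Context: $F$ is monotone if nondecreasing in each coordinate. A $C^2$ function $F$ is one-sided $\sigma$-smooth (on its domain) if for all $u,x\ge0$ with $x\ne0$: $\frac12u^T\nabla^2F(x)u\le\sigma\frac{\|u\|_1}{\|x\|_1}u^T\nabla F(x)$. $P$ is downward-closed if $y\in P$ and $0\le x\le y$ imply $x\in P$. Jump-start continuous greedy with parameter $\alpha$: let $v^*\in\arg\max_{x\in P}\|x\|_1$, let $v_{max}(x)\in\arg\max_{v\in P}v^T\nabla F(x)$, and let $x(t)$ solve $x'(t)=(1-\alpha)v_{max}(x(t))$ for $t\in[0,1]$ with $x(0)=\alpha v^*$. *)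

(* Defs.v *)
From HB Require Import structures.
From mathcomp Require Import all_boot all_order all_algebra.
From mathcomp Require Import all_classical all_reals all_analysis.

Set Implicit Arguments.
Unset Strict Implicit.
Unset Printing Implicit Defensive.

Import Order.TTheory GRing.Theory Num.Theory.
Import numFieldNormedType.Exports.

Local Open Scope classical_set_scope.
Local Open Scope ring_scope.

Section Vectors.
Context {R : realType} {n : nat}.
Implicit Types (x y u v : 'rV[R]_n) (P : set 'rV[R]_n).

Definition vle x y : Prop := forall i, x 0 i <= y 0 i.

Definition dotv u v : R := \sum_i u 0 i * v 0 i.

(* The norm `|x| of the library on 'rV[R]_n is the sup norm. *)
Definition norm1 x : R := \sum_i `|x 0 i|.

Definition cube : set 'rV[R]_n := [set x | vle 0 x /\ vle x (const_mx 1)].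

Definition polyhedron P : Prop :=
  exists (m : nat) (A : 'M[R]_(m, n)) (b : 'cV[R]_m),
    P = [set x | forall k, (A *m x^T) k 0 <= b k 0].

Definition polytope P : Prop := polyhedron P /\ bounded_set P.

Definition downward_closed P : Prop :=
  forall x y, P y -> vle 0 x -> vle x y -> P x.

End Vectors.

Definition argmax {R : realType} {T : Type} (A : set T) (f : T -> R) : set T :=
  [set x | A x /\ forall y, A y -> f y <= f x].

Definition is_maximum {R : realType} (S : set R) (m : R) : Prop :=
  S m /\ ubound S m.

(* Calculus on the closed cube.  Difference quotients only use increments that
   stay in the cube, so partial derivatives are the usual two-sided ones when
   0 < x_i < 1 and one-sided ones when x_i is 0 or 1; a function
   'rV[R]_n -> R is thus only ever looked at on its domain [0,1]^n. *)
Section CubeCalculus.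
Context {R : realType} {n : nat}.
Implicit Types (f : 'rV[R]_n -> R) (x : 'rV[R]_n) (i : 'I_n).

Definition diff_quotient i f x (h : R) : R :=
  h^-1 * (f (x + h *: delta_mx 0 i) - f x).

Definition increments i x : set_system R :=
  within [set h : R | cube (x + h *: delta_mx 0 i)] (0 : R)^'.

Definition has_partial i f x : Prop :=
  cvg (diff_quotient i f x @ increments i x).

Definition partial i f x : R := lim (diff_quotient i f x @ increments i x).

Fixpoint Ck_on_cube (k : nat) f : Prop :=
  {within cube, continuous f} /\
  if k is k'.+1 then
    forall i, (forall x, cube x -> has_partial i f x) /\
              Ck_on_cube k' (partial i f)
  else True.

Definition grad f x : 'rV[R]_n := \row_i partial i f x.

Definition hess f x : 'M[R]_n := \matrix_(i, j) partial i (partial j f) x.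

Definition monotone_on_cube f : Prop :=
  forall x y, cube x -> cube y -> vle x y -> f x <= f y.

Definition one_sided_smooth (sigma : R) f : Prop :=
  Ck_on_cube 2 f /\
  forall u x, vle 0 u -> cube x -> x != 0 ->
    2^-1 * (u *m hess f x *m u^T) 0 0
      <= sigma * (norm1 u / norm1 x) * dotv u (grad f x).

End CubeCalculus.

Definition abs_continuous {R : realType} {V : normedModType R} (a b : R)
    (f : R -> V) : Prop :=
  forall eps : R, 0 < eps -> exists2 delta : R, 0 < delta &
    forall (m : nat) (l r : 'I_m -> R),
      (forall k, [/\ a <= l k, l k <= r k & r k <= b]) ->
      (forall j k, j != k -> r j <= l k \/ r k <= l j) ->
      \sum_k (r k - l k) < delta ->
      \sum_k `|f (r k) - f (l k)| < eps.

(* The field vfield is a (in general discontinuous) selection of an argmax, so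
   the differential equation is meant in the sense of Caratheodory: x is
   absolutely continuous and satisfies the equation for almost every time.
   Since vfield only makes sense on D, a solution takes its values in D. *)
Definition ode_solution {R : realType} {n : nat} (D : set 'rV[R]_n)
    (vfield : 'rV[R]_n -> 'rV[R]_n) (x0 : 'rV[R]_n) (x : R -> 'rV[R]_n) : Prop :=
  [/\ x 0 = x0,
      forall t, 0 <= t <= 1 -> D (x t),
      abs_continuous 0 1 x
    & {ae lebesgue_measure, forall t : R,
        0 < t < 1 -> is_derive t (1 : R) x (vfield (x t))}].

Definition jump_start_trajectory {R : realType} {n : nat}
    (F : 'rV[R]_n -> R) (P : set 'rV[R]_n) (alpha : R)
    (vstar : 'rV[R]_n) (vmax : 'rV[R]_n -> 'rV[R]_n) (x : R -> 'rV[R]_n) : Prop :=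
  [/\ argmax P norm1 vstar,
      forall y, cube y -> argmax P (fun v => dotv v (grad F y)) (vmax y)
    & ode_solution cube (fun y => (1 - alpha) *: vmax y) (alpha *: vstar) x].

(* Main.v *)
Require Import Defs.
From mathcomp Require Import all_boot all_order all_algebra.
From mathcomp Require Import all_classical all_reals all_analysis.
From mathcomp Require Import measurable_realfun ring lra.
Import Order.TTheory GRing.Theory Num.Theory.
Import numFieldNormedType.Exports.
Local Open Scope classical_set_scope.
Local Open Scope ring_scope.

(** Let [kappa = (alpha / (alpha + 1)) ^ (2 sigma)].  At a point [x] of the
    trajectory put [u = (x \/ xopt) - x], which lies in [P] by downward closure.
    With [g s = u . grad F (x + s u)], one-sided smoothness reads
    [g' s <= 2 sigma / (r + s) * g s] for [r = |x|_1 / |u|_1 >= alpha], so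
    [kappa * g s <= g 0] and, integrating,
    [kappa * (OPT - F x) <= g 0 <= vmax x . grad F x].  Gronwall's inequality along
    the trajectory concludes; [x 1] is in [P] because it satisfies each linear
    constraint.  Since the trajectory is only absolutely continuous, both steps rest
    on the fact that an absolutely continuous function with almost everywhere
    nonnegative derivative is nondecreasing: the exceptional null set is covered by
    an open set of small measure, and real induction advances either inside this
    open set or by the derivative bound. *)

(** * Derivatives and absolute continuity on the real line *)

(** First-order expansion with a non-strict error bound: it also holds at [s = t], so no punctured
    neighbourhood remains. Real induction and the chain rule both consume derivatives in this
    form. *)
Lemma is_derive_nearP {R : realType} {V : normedModType R} (f : R -> V)
    (t : R) (d : V) :
  is_derive t (1 : R) f d <->
  forall e, 0 < e -> \forall s \near t,
    `|f s - f t - (s - t) *: d| <= e * `|s - t|.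
Proof.
split=> [[df dv] e e0|H].
  have : h^-1 *: (f (h + t) - f t) @[h --> 0^'] --> d.
    have := df; rewrite /derivable -dv /derive /= => /cvgP.
    by under eq_fun do rewrite /= scaler1; exact.
  move=> /cvgrPdist_le/(_ _ e0)/nbhs_ballP[/= r r0 Hr].
  apply/nbhs_ballP; exists r => //= s; rewrite /ball /= => ts.
  have [->|st] := eqVneq s t; first by rewrite !subrr scale0r subr0 !normr0 mulr0.
  have /= := Hr (s - t); rewrite /ball /= sub0r opprB => /(_ ts).
  rewrite subr_eq0 => /(_ st); rewrite subrK -(ler_pM2r (_ : 0 < `|s - t|)); last first.
    by rewrite normr_gt0 subr_eq0.
  rewrite (mulrC `|_ - _ *: _|) -normrZ scalerBr scalerA mulfV ?subr_eq0// scale1r.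
  by rewrite distrC.
have : h^-1 *: (f (h *: (1:R) + t) - f t) @[h --> 0^'] --> d.
  apply/cvgrPdist_le => e e0.
  have [/= r r0 Hr] := (nbhs_ballP _ _).1 (H _ e0).
  apply/nbhs_ballP; exists r => //= h; rewrite /ball /= sub0r normrN => hr h0.
  have /= := Hr (h + t); rewrite /ball /= opprD addrCA subrr addr0 normrN => /(_ hr).
  rewrite addrK -(ler_pM2l (_ : 0 < `|h|^-1)) ?invr_gt0 ?normr_gt0//.
  rewrite mulrCA mulVf ?normr_eq0// mulr1 -normfV -normrZ scalerBr scalerA.
  rewrite mulVf// scale1r distrC.
  by rewrite /GRing.scale /= mulr1.
move=> c; split; first by apply/cvg_ex; exists d.
exact: (cvg_lim _ c).
Qed.

Lemma abs_continuous_sub {R : realType} {V : normedModType R} (a b c d : R)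
    (f : R -> V) :
  a <= c -> d <= b -> abs_continuous a b f -> abs_continuous c d f.
Proof.
move=> ac db H e /H[del d0 {}H]; exists del => // m l r lr; apply: H => k.
by have [? ? ?] := lr k; split=> //; [exact: le_trans ac _|exact: le_trans db].
Qed.

(** The term [r - l] lets [g] depend on time directly as well as through [f], as for
    [dotv (x t) a - c * t] or a product with an exponential of [t]. *)
Lemma abs_continuous_dom {R : realType} {V W : normedModType R} (a b K : R)
    (f : R -> V) (g : R -> W) : 0 <= K ->
  (forall l r, a <= l -> l <= r -> r <= b ->
    `|g r - g l| <= K * (`|f r - f l| + (r - l))) ->
  abs_continuous a b f -> abs_continuous a b g.
Proof.
move=> K0 gf H e e0.
have e1 : 0 < e / (2 * (K + 1)) by rewrite divr_gt0// mulr_gt0// ltr_wpDl.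
have [del d0 {}H] := H _ e1.
exists (Num.min del (e / (2 * (K + 1)))); first by rewrite lt_min d0.
move=> m l r lr dis; rewrite lt_min => /andP[s1 s2].
have := H _ _ _ lr dis s1 => s3.
apply: (@le_lt_trans _ _ (\sum_k K * (`|f (r k) - f (l k)| + (r k - l k)))).
  by apply: ler_sum => k _; have [? ? ?] := lr k; exact: gf.
rewrite -mulr_sumr big_split/=.
apply: (@le_lt_trans _ _ ((K + 1) * (\sum_k `|f (r k) - f (l k)| + \sum_k (r k - l k)))).
  rewrite ler_wpM2r ?lerDl// addr_ge0 ?sumr_ge0// => k _.
  by have [_ ? _] := lr k; rewrite subr_ge0.
rewrite -ltr_pdivlMl ?ltr_wpDl//.
have -> : (K + 1)^-1 * e = e / (2 * (K + 1)) + e / (2 * (K + 1)).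
  by field; rewrite gt_eqF// ltr_wpDl.
exact: ltrD.
Qed.

(** * Monotonicity from an almost everywhere nonnegative derivative *)

Section abs_continuous_monotone.
Context {R : realType} (a b : R) (f : R -> R) (e : R) (U : set R).
Hypotheses (e0 : 0 < e) (oU : open U).

(* [f t - f a] is bounded below up to the variation of [f] over finitely many
   intervals packed inside [U]. *)
Let packed (t : R) : Prop := exists (m : nat) (l r : 'I_m -> R),
  [/\ forall k, [/\ a <= l k, l k <= r k & r k <= t],
      forall j k, j != k -> r j <= l k \/ r k <= l j,
      ((\sum_k (r k - l k))%:E <= lebesgue_measure (U `&` `[a, t]))%E &
      - e * (t - a) - \sum_k `|f (r k) - f (l k)| <= f t - f a].

(** The two ways to advance: inside [U], where the variation of [f] is charged to absolute
    continuity, or with a loss of at most [e] per unit of time. *)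
Let step (s t : R) : Prop := `[s, t] `<=` U \/ - e * (t - s) <= f t - f s.

Let mU : measurable U. Proof. exact: open_measurable. Qed.

(** If [[s, t]] lies in [U], it joins the packing and the measure of the part of [U] covered so far
    grows by its full length; otherwise the packing is kept and the slope bound is added. *)
Let packed_step (s t : R) : a <= s -> s <= t -> packed s -> step s t -> packed t.
Proof.
move=> as_ st [m [l [r [lr dis mu fs]]]] [sU|ft]; last first.
  exists m, l, r; split => //.
  - by move=> k; have [? ? ?] := lr k; split => //; exact: le_trans st.
  - apply: (le_trans mu); apply: le_measure; rewrite ?inE.
    + by apply: measurableI.
    + by apply: measurableI.
    apply: setIS => x /=; rewrite !in_itv/= => /andP[-> xs]/=; exact: le_trans st.
  - lra.
(* The new interval gets index [ord_max]; [unlift] recovers the old indices. *)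
pose l' (k : 'I_m.+1) := oapp l s (unlift ord_max k).
pose r' (k : 'I_m.+1) := oapp r t (unlift ord_max k).
have lE k : l' (widen_ord (leqnSn m) k) = l k.
  rewrite /l' (_ : widen_ord _ _ = lift ord_max k) ?liftK//.
  by apply: val_inj; rewrite /= /bump leqNgt ltn_ord.
have rE k : r' (widen_ord (leqnSn m) k) = r k.
  rewrite /r' (_ : widen_ord _ _ = lift ord_max k) ?liftK//.
  by apply: val_inj; rewrite /= /bump leqNgt ltn_ord.
have lM : l' ord_max = s by rewrite /l' unlift_none.
have rM : r' ord_max = t by rewrite /r' unlift_none.
exists m.+1, l', r'; split.
- move=> k; rewrite /l' /r'; case: unliftP => [j|] _ /=; last by split.
  by have [? ? ?] := lr j; split => //; exact: le_trans st.
- move=> j k; rewrite /l' /r'.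
  case: unliftP => [j'|] -> /=; case: unliftP => [k'|] -> /=.
  + by rewrite (inj_eq lift_inj); exact: dis.
  + by left; have [] := lr j'.
  + by right; have [] := lr k'.
  + by rewrite eqxx.
- rewrite big_ord_recr/= lM rM; under eq_bigr do rewrite lE rE.
  (* The half-open []s, t]] makes the union disjoint, so that the measures add up. *)
  have sub : (U `&` `[a, s]) `|` `]s, t] `<=` U `&` `[a, t].
    move=> x /= [[Ux]|].
      by rewrite !in_itv/= => /andP[-> xs]; split => //=; exact: le_trans st.
    rewrite !in_itv/= => /andP[sx xt]; split.
      by apply: sU; rewrite /= in_itv/= (ltW sx).
    by rewrite xt (le_trans as_ (ltW sx)).
  apply: (@le_trans _ _ (lebesgue_measure (U `&` `[a, s] `|` `]s, t]))); last first.
    apply: le_measure => //; rewrite inE; last exact: measurableI.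
    by apply: measurableU => //; exact: measurableI.
  rewrite measureU//; last 2 first.
  + by apply: measurableI.
  + rewrite -subset0 => x /= [[_]]; rewrite !in_itv/= => /andP[_ xs] /andP[sx _].
    by have := le_lt_trans xs sx; rewrite ltxx.
  rewrite EFinD leeD//= lebesgue_measure_itv/= lte_fin.
  by case: ltP => // ts; rewrite lee_fin subr_le0.
- rewrite big_ord_recr/= lM rM; under eq_bigr do rewrite lE rE.
  have := ler_norm (f s - f t); rewrite distrC => h.
  have : 0 <= e * (t - s) by rewrite mulr_ge0 ?subr_ge0// ltW.
  lra.
Qed.

Hypothesis near_step : forall t, a <= t <= b -> U t \/
  \forall s \near t, (s <= t -> step s t) /\ (t <= s -> step t s).

Let near_step' t : a <= t <= b -> exists2 r, 0 < r & forall s, `|s - t| < r ->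
  (s <= t -> step s t) /\ (t <= s -> step t s).
Proof.
move=> /near_step[Ut|].
  have /nbhs_ballP[r /= r0 Hr] := open_nbhs_nbhs (conj oU Ut).
  exists r => // s; rewrite ltr_distl => /andP[h1 h2].
  split => st; left => x /=; rewrite in_itv/= => /andP[sx xt]; apply: Hr;
    rewrite /ball/= ltr_distl; apply/andP; split; lra.
move=> /nbhs_ballP[r /= r0 Hr]; exists r => // s sr.
by apply: Hr; rewrite /ball/= distrC.
Qed.

(* Real induction: the points reachable from [a] form a closed and open
   subset of [[a, b]]. *)
Let packed_end : a <= b -> packed b.
Proof.
move=> ab.
have pa : packed a.
  exists 0, (fun=> a), (fun=> a); rewrite !big_ord0; split=> //; first by case.
  by rewrite !subrr mulr0 oppr0 addr0.
pose S := [set t | a <= t <= b /\ packed t].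
have Sa : S a by rewrite /S/= lexx ab.
have supS : has_sup S.
  split; first by exists a.
  by exists b => t [/andP[]].
set s := sup S.
have leS t : S t -> t <= s by move=> St; exact: (sup_upper_bound supS St).
have as_ : a <= s by exact: leS.
have sb : s <= b by apply: ge_sup => [|t [/andP[]]//]; exists a.
have [|r r0 Hr] := @near_step' s; first by rewrite as_.
have ps : packed s.
  have [t [/andP[at_ tb] pt] st] := sup_adherent r0 supS.
  have ts : t <= s by apply: leS; rewrite /S/= at_ tb.
  apply: (packed_step t s) => //; apply: (Hr t _).1 => //.
  rewrite -/s in st; rewrite ltr_distl; apply/andP; split; lra.
move: sb; rewrite le_eqVlt => /predU1P[<-//|sb].
(* A point beyond the supremum [s], yet within [b] and within reach of one step from [s]: a
   contradiction. *)
pose t := Num.min b (s + r / 2).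
have st : s < t by rewrite /t lt_min sb ltrDl divr_gt0.
have tb : t <= b by rewrite /t ge_min lexx.
have tr : t <= s + r / 2 by rewrite /t ge_min lexx orbT.
have pt : packed t.
  apply: (packed_step s t) => //; first exact: ltW.
  apply: (Hr t _).2; last exact: ltW.
  rewrite ltr_distl; apply/andP; split; lra.
have : t <= s by apply: leS; split=> //; rewrite tb (le_trans as_ (ltW st)).
by rewrite leNgt st.
Qed.

(** The packed intervals have total length at most the measure of [U], hence below [del], so the
    variation of [f] over them costs at most [e]. *)
Lemma abs_continuous_lower_bound (del : R) : a <= b ->
  (lebesgue_measure U < del%:E)%E ->
  (forall (m : nat) (l r : 'I_m -> R),
      (forall k, [/\ a <= l k, l k <= r k & r k <= b]) ->
      (forall j k, j != k -> r j <= l k \/ r k <= l j) ->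
      \sum_k (r k - l k) < del ->
      \sum_k `|f (r k) - f (l k)| < e) ->
  - e * (b - a) - e <= f b - f a.
Proof.
move=> ab Udel H; have [m [l [r [lr dis mu fb]]]] := packed_end ab.
apply: le_trans fb; rewrite lerD2l lerN2 ltW//; apply: H => //.
rewrite -lte_fin; apply: le_lt_trans mu _; apply: le_lt_trans Udel.
by apply: le_measure; rewrite ?inE//; apply: measurableI.
Qed.

End abs_continuous_monotone.

Lemma ge0_ae_derive_le {R : realType} (a b : R) (f : R -> R) : a <= b ->
  abs_continuous a b f ->
  {ae lebesgue_measure, forall t : R,
    a < t < b -> exists2 d, 0 <= d & is_derive t (1 : R) f d} ->
  f a <= f b.
Proof.
move=> ab acf [A [mA A0 NA]].
suff H e : 0 < e -> - e * (b - a) - e <= f b - f a.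
  apply/ler_addgt0Pl => e e0.
  have ba : 0 < b - a + 1 by rewrite ltr_wpDl// subr_ge0.
  (* With this choice the total loss is exactly [e]. *)
  have := H (e / (b - a + 1)) (divr_gt0 e0 ba).
  have -> : - (e / (b - a + 1)) * (b - a) - e / (b - a + 1) = - e.
    by field; rewrite gt_eqF.
  lra.
move=> e0; have [del del0 Hdel] := acf _ e0.
(* The endpoints join the null set, since derivatives are given only for [a < t < b]. *)
have mB : measurable (A `|` [set a; b]) by apply: measurableU => //; exact: measurableU.
have B0 : lebesgue_measure (A `|` [set a; b]) = 0%E.
  rewrite measureU0//; first exact: measurableU.
  by rewrite measureU0//; exact: lebesgue_measure_set1.
have fB : (lebesgue_measure (A `|` [set a; b]) < +oo)%E by rewrite B0.
have [U [oU BU Udel]] := lebesgue_regularity_outer mB fB del0.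
apply: (@abs_continuous_lower_bound _ a b f e U e0 oU _ del ab _ Hdel).
  move=> t /andP[at_ tb]; have [Ut|nUt] := pselect (U t); [by left|right].
  have nB : ~ (A `|` [set a; b]) t by move/BU.
  have ta : t != a by apply/eqP => taE; apply: nB; right; left.
  have tb' : t != b by apply/eqP => tbE; apply: nB; right; right.
  have [|d d0 /is_derive_nearP/(_ _ e0) df] : a < t < b -> exists2 d, 0 <= d & is_derive t (1:R) f d.
  - by apply: contrapT => h; apply: nB; left; exact: NA.
  - by rewrite !lt_neqAle at_ tb eq_sym ta tb'.
  apply: filterS df => s; rewrite /GRing.scale/= => hs; split => st; right.
  - have h2 : 0 <= (t - s) * d by rewrite mulr_ge0// subr_ge0.
    move: hs; rewrite ler_norml (ler0_norm (_ : s - t <= 0)) ?subr_le0// => /andP[]; lra.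
  - have h2 : 0 <= (s - t) * d by rewrite mulr_ge0// subr_ge0.
    move: hs; rewrite ler_norml (ger0_norm (_ : 0 <= s - t)) ?subr_ge0// => /andP[]; lra.
(* Outer regularity bounds [U] minus the null set; putting the null set back does not change the
   measure. *)
have mUB : measurable (U `\` (A `|` [set a; b])).
  by apply: measurableD => //; exact: open_measurable.
apply: le_lt_trans Udel.
by rewrite -[in leLHS](setDKU BU) measureU0.
Qed.
Set Implicit Arguments.
Unset Strict Implicit.

(** * First-order calculus on the closed cube *)

Section CubeC1.
Context {R : realType} {n : nat}.
Implicit Types (f : 'rV[R]_n -> R) (x y z u v : 'rV[R]_n) (i j : 'I_n).

Lemma norm_coord_le x i : `|x 0 i| <= `|x|.
Proof.
rewrite [leRHS]/Num.norm /= mx_normrE; apply/bigmax_geP; right.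
by exists (0, i).
Qed.

Lemma norm_le_coord x (c : R) : 0 <= c -> (forall i, `|x 0 i| <= c) -> `|x| <= c.
Proof.
move=> c0 xc; rewrite [leLHS]/Num.norm /= mx_normrE; apply/bigmax_leP; split => //.
by move=> [k i] _ /=; rewrite (ord1 k).
Qed.

Lemma dotvDl u v x : dotv (u + v) x = dotv u x + dotv v x.
Proof. by rewrite -big_split; apply: eq_bigr => i _; rewrite mxE mulrDl. Qed.

Lemma dotvZl (c : R) u x : dotv (c *: u) x = c * dotv u x.
Proof. by rewrite mulr_sumr; apply: eq_bigr => i _; rewrite mxE mulrA. Qed.

Lemma dotvBl u v x : dotv (u - v) x = dotv u x - dotv v x.
Proof. by rewrite dotvDl -scaleN1r dotvZl mulN1r. Qed.

Lemma norm1_ge0 x : 0 <= norm1 x.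
Proof. exact: sumr_ge0. Qed.

Lemma dotv_norm_le u x : `|dotv u x| <= `|u| * norm1 x.
Proof.
apply: le_trans (ler_norm_sum _ _ _) _; rewrite mulr_sumr; apply: ler_sum => i _.
by rewrite normrM ler_wpM2r// norm_coord_le.
Qed.

Lemma cube_compact : compact (@cube R n).
Proof.
have cI : compact [set v : 'rV[R]_n | forall i, v ord0 i \in `[0 : R, 1 : R]].
  apply: (@rV_compact R n (fun=> `[0 : R, 1 : R]%classic)) => i.
  exact: segment_compact.
rewrite (_ : cube = [set v : 'rV[R]_n | forall i, v ord0 i \in `[0 : R, 1 : R]])//.
apply/seteqP; split => [x [x0 x1] i /=|x /= x01].
  by rewrite in_itv/=; move: (x0 i) (x1 i); rewrite !mxE => -> ->.
by split => i; rewrite mxE; have := x01 i; rewrite in_itv/= => /andP[].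
Qed.

Lemma coord_shift y (s : R) i j :
  (y + s *: delta_mx 0 i) 0 j = y 0 j + s * (j == i)%:R.
Proof. by rewrite !mxE eqxx. Qed.

Lemma cube_shift y (h s : R) i : cube y -> cube (y + h *: delta_mx 0 i) ->
  Num.min 0 h <= s <= Num.max 0 h -> cube (y + s *: delta_mx 0 i).
Proof.
move=> [y0 y1] [h0 h1] /andP[s0 s1].
have C j : 0 <= y 0 j + s * (j == i)%:R <= 1.
  move: (y0 j) (y1 j) (h0 j) (h1 j); rewrite !coord_shift !mxE.
  case: eqP => _; rewrite ?(mulr1, mulr0); move: s0 s1; have [] := leP 0 h; lra.
by split => j; rewrite coord_shift mxE; have /andP[] := C j.
Qed.

(** For [s] strictly between [a] and [b], all small increments stay in the cube, so the restricted
    filter in [partial] gives the usual two-sided limit. *)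
Lemma is_derive_partial f y i (a b s : R) : Ck_on_cube 1 f ->
  (forall r, a <= r <= b -> cube (y + r *: delta_mx 0 i)) -> a < s < b ->
  is_derive s (1 : R) (fun r => f (y + r *: delta_mx 0 i))
    (partial i f (y + s *: delta_mx 0 i)).
Proof.
move=> [_ /(_ i) [pf _]] cab /andP[sa sb].
set w := y + s *: delta_mx 0 i.
have cw : cube w by apply: cab; rewrite !ltW.
have dq : diff_quotient i f w h @[h --> 0^'] --> partial i f w.
  move=> B /(pf w cw) /= HB.
  have : \forall h \near 0^', cube (w + h *: delta_mx 0 i).
    apply/nbhs_ballP; exists (Num.min (s - a) (b - s)) => /=.
      by rewrite lt_min !subr_gt0 sa.
    move=> h; rewrite /ball/= sub0r normrN lt_min !ltr_norml.
    move=> /andP[/andP[h1 h2] /andP[h3 h4]] _.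
    rewrite /w -addrA -scalerDl; apply: cab; lra.
  move=> /filterI/(_ HB); apply: filterS => h [ch]; exact.
have c : h^-1 *: (f (y + (h *: (1:R) + s) *: delta_mx 0 i) - f w) @[h --> 0^'] -->
    partial i f w.
  apply: cvg_trans dq; apply: near_eq_cvg; near=> h.
  have -> : h *: (1 : R) + s = s + h by rewrite addrC /GRing.scale/= mulr1.
  by rewrite /diff_quotient /w scalerDl addrA.
split; first by apply/cvg_ex; exists (partial i f w).
exact: (cvg_lim _ c).
Unshelve. all: by end_near.
Qed.

Lemma cube_continuous_dist f y (e : R) : {within cube, continuous f} ->
  cube y -> 0 < e ->
  \forall z \near within cube (nbhs y), `|f z - f y| <= e.
Proof.
move=> /subspace_continuousP/[apply] /cvgrPdist_le/[apply].
by apply: filterS => z; rewrite distrC.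
Qed.

(** Working between [Num.min 0 h] and [Num.max 0 h] treats both signs of [h] at once. At the ends,
    possibly on the boundary of the cube, continuity is enough for the mean value theorem. *)
Lemma partial_mvt f y (h : R) i : Ck_on_cube 1 f -> cube y ->
  cube (y + h *: delta_mx 0 i) ->
  exists c : R, [/\ `|c| <= `|h|, cube (y + c *: delta_mx 0 i) &
    f (y + h *: delta_mx 0 i) - f y = h * partial i f (y + c *: delta_mx 0 i)].
Proof.
move=> C1f cy cyh.
pose phi (r : R) := f (y + r *: delta_mx 0 i).
have cab r : Num.min 0 h <= r <= Num.max 0 h -> cube (y + r *: delta_mx 0 i).
  exact: cube_shift.
have [|||c] := @MVT_segment _ phi (fun r => partial i f (y + r *: delta_mx 0 i))
   (Num.min 0 h) (Num.max 0 h).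
- by rewrite ge_min !le_max lexx.
- by move=> s; rewrite in_itv/=; exact: is_derive_partial.
- apply/subspace_continuousP => s /=; rewrite in_itv/= => sh.
  apply/cvgrPdist_le => e e0.
  have := cube_continuous_dist C1f.1 (cab _ sh) e0.
  move=> /nbhs_ballP[r /= r0 Hr]; apply/nbhs_ballP; exists r => //= t.
  rewrite /ball/= in_itv/= => st /cab ct.
  rewrite distrC; apply: Hr => //.
  rewrite -ball_normE /= opprD addrACA subrr add0r -scalerBl normrZ.
  apply: le_lt_trans st; rewrite -[leRHS]mulr1 ler_wpM2l//.
  apply: norm_le_coord => // j; rewrite mxE eqxx/=.
  by case: (j == i); rewrite ?normr0 ?normr1.
rewrite in_itv/= => ch mvt; exists c; split; last 1 first.
- move: mvt; rewrite /phi; have [h0|h0] := leP 0 h.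
    by rewrite scale0r addr0 subr0 mulrC.
  by rewrite scale0r addr0 sub0r mulrN mulrC => /(congr1 -%R); rewrite opprB opprK.
- move: ch; have [h0|h0] := leP 0 h => /andP[h1 h2].
    by rewrite !ger0_norm.
  by rewrite !ler0_norm ?lerN2// ltW.
- exact: cab.
Qed.

(** Move from [y] to [z] one coordinate at a time and telescope. The intermediate points mix
    coordinates of [y] and [z], so they stay in the cube and within [z - y] of [y] in sup norm. *)
Lemma cube_mvt f y z : Ck_on_cube 1 f -> cube y -> cube z ->
  exists2 xi : 'I_n -> 'rV[R]_n,
    (forall i, cube (xi i) /\ `|xi i - y| <= `|z - y|) &
    f z - f y = \sum_i (z 0 i - y 0 i) * partial i f (xi i).
Proof.
move=> C1f [y0 y1] [z0 z1].
pose w (k : nat) : 'rV[R]_n := \row_j if (j < k)%N then z 0 j else y 0 j.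
have cw k : cube (w k).
  by split => j; rewrite !mxE; case: ifP => _;
    [have := z0 j|have := y0 j|have := z1 j|have := y1 j]; rewrite !mxE.
have wS i : w i.+1 = w i + (z 0 i - y 0 i) *: delta_mx 0 i.
  apply/rowP => j; rewrite coord_shift !mxE ltnS leq_eqVlt val_eqE.
  case: eqVneq => [->|_]; last by rewrite mulr0 addr0.
  by rewrite ltnn mulr1 addrC subrK.
have w0 : w 0%N = y by apply/rowP => j; rewrite mxE.
have wn : w n = z by apply/rowP => j; rewrite mxE ltn_ord.
have H i : exists xi : 'rV[R]_n, (cube xi /\ `|xi - y| <= `|z - y|) /\
    f (w i.+1) - f (w i) = (z 0 i - y 0 i) * partial i f xi.
  have := cw i.+1; rewrite wS => /(partial_mvt C1f (cw i))[c [ch cc ->]].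
  exists (w i + c *: delta_mx 0 i); split => //; split => //.
  apply: norm_le_coord => // j; rewrite mxE coord_shift !mxE.
  case: (eqVneq j i) => [->|_].
    rewrite ltnn mulr1 addrAC subrr add0r; apply: le_trans ch _.
    by have := norm_coord_le (z - y) i; rewrite !mxE.
  rewrite mulr0 addr0; case: ifP => _; last by rewrite subrr normr0.
  by have := norm_coord_le (z - y) j; rewrite !mxE.
have [xi Hxi] := choice H.
exists xi => [i|]; first exact: (Hxi i).1.
rewrite -{1}wn -{1}w0 -(telescope_sumr (f \o w))// big_mkord.
by apply: eq_bigr => i _; exact: (Hxi i).2.
Qed.

(** The points of [cube_mvt] are as close to [y] as [z] is, so continuity of the partial derivatives
    at [y] gives differentiability relative to the cube, boundary included. *)
Lemma cube_differentiable f y (e : R) : Ck_on_cube 1 f -> cube y -> 0 < e ->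
  \forall z \near within cube (nbhs y),
    `|f z - f y - dotv (z - y) (grad f y)| <= e * `|z - y|.
Proof.
move=> C1f cy e0.
(* Dividing by [n.+1] rather than [n] also covers dimension zero. *)
have e1 : 0 < e / n.+1%:R by rewrite divr_gt0.
have : \forall z \near within cube (nbhs y), forall i,
    `|partial i f z - partial i f y| <= e / n.+1%:R.
  apply: filter_forall => i.
  by apply: cube_continuous_dist => //; have [_ []] := C1f.2 i.
move=> /nbhs_ballP[r /= r0 Hr]; apply/nbhs_ballP; exists r => //= z.
rewrite -ball_normE/= distrC => yz cz.
have [xi Hxi ->] := cube_mvt C1f cy cz.
rewrite -sumrB; apply: le_trans (ler_norm_sum _ _ _) _.
apply: (@le_trans _ _ (\sum_(i < n) `|z - y| * (e / n.+1%:R))).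
  apply: ler_sum => i _; rewrite !mxE -mulrBr normrM ler_pM//.
    by have := norm_coord_le (z - y) i; rewrite !mxE.
  apply: Hr; last exact: (Hxi i).1.
  by rewrite -ball_normE/= distrC; exact: le_lt_trans (Hxi i).2 yz.
rewrite sumr_const card_ord -mulrnAr mulrC ler_wpM2r//.
rewrite -mulr_natr -mulrA ler_piMr ?(ltW e0)//.
by rewrite mulrC ler_pdivrMr// mul1r ler_nat.
Qed.

(** The partial derivatives are continuous on a compact cube, hence bounded; for the sup norm the
    sum of their bounds is a Lipschitz constant. *)
Lemma cube_lipschitz f : Ck_on_cube 1 f -> exists2 K : R, 0 <= K &
  forall y z, cube y -> cube z -> `|f z - f y| <= K * `|z - y|.
Proof.
move=> C1f.
have H i : exists M : R, 0 <= M /\ forall z, cube z -> `|partial i f z| <= M.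
  have [_ [cp _]] := C1f.2 i.
  have [M [_ HM]] := compact_bounded (continuous_compact cp cube_compact).
  exists (`|M| + 1); split; first by rewrite addr_ge0.
  move=> z cz; apply: (HM (`|M| + 1)); last by exists z.
  by rewrite (le_lt_trans (ler_norm M))// ltrDl.
have [M HM] := choice H.
exists (\sum_i M i); first by apply: sumr_ge0 => i _; exact: (HM i).1.
move=> y z cy cz; have [xi Hxi ->] := cube_mvt C1f cy cz.
apply: le_trans (ler_norm_sum _ _ _) _; rewrite mulr_suml; apply: ler_sum => i _.
rewrite normrM mulrC ler_pM//; first exact: (HM i).2 (Hxi i).1.
by have := norm_coord_le (z - y) i; rewrite !mxE.
Qed.

Lemma is_derive_cube_comp f (x : R -> 'rV[R]_n) (t : R) (d : 'rV[R]_n) :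
  Ck_on_cube 1 f -> (\forall s \near t, cube (x s)) ->
  is_derive t (1 : R) x d ->
  is_derive t (1 : R) (f \o x) (dotv d (grad f (x t))).
Proof.
move=> C1f cx /is_derive_nearP dx; apply/is_derive_nearP => e e0.
set g := grad f (x t).
have cxt : cube (x t) := nbhs_singleton cx.
have L0 : 0 < `|d| + 1 by rewrite ltr_wpDl.
have G0 : 0 < norm1 g + 1 by rewrite ltr_wpDl// norm1_ge0.
(* Two errors share [e]: that of [f], scaled by the speed bound [|d| + 1] of the curve, and that of
   the curve, scaled by the l1 norm of the gradient. Each is allotted [e / 2]. *)
have e1 : 0 < e / (2 * (`|d| + 1)) by rewrite divr_gt0// mulr_gt0.
have e2 : 0 < e / (2 * (norm1 g + 1)) by rewrite divr_gt0// mulr_gt0.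
have /nbhs_ballP[r /= r0 Hr] := cube_differentiable C1f cxt e1.
have rL : 0 < r / (`|d| + 1) by rewrite divr_gt0.
near=> s.
have cs : cube (x s) by near: s.
have xs : `|x s - x t| <= (`|d| + 1) * `|s - t|.
  have -> : x s - x t = x s - x t - (s - t) *: d + (s - t) *: d by rewrite subrK.
  apply: le_trans (ler_normD _ _) _; rewrite normrZ mulrDl mul1r addrC mulrC lerD2l.
  by rewrite -[leRHS]mul1r; near: s; exact: dx.
have xr : `|x s - x t| < r.
  by apply: le_lt_trans xs _; rewrite mulrC -ltr_pdivlMr.
have := Hr (x s); rewrite -ball_normE/= distrC => /(_ xr cs) h1.
have h2 : `|x s - x t - (s - t) *: d| <= e / (2 * (norm1 g + 1)) * `|s - t|.
  by near: s; exact: dx.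
have -> : f (x s) - f (x t) - (s - t) *: dotv d g =
    (f (x s) - f (x t) - dotv (x s - x t) g) + dotv (x s - x t - (s - t) *: d) g.
  by rewrite (dotvBl (x s - x t)) dotvZl /GRing.scale/=; ring.
apply: le_trans (ler_normD _ _) _.
have -> : e * `|s - t| = e / 2 * `|s - t| + e / 2 * `|s - t| by field.
apply: lerD.
  apply: le_trans h1 _.
  have -> : e / 2 * `|s - t| = e / (2 * (`|d| + 1)) * ((`|d| + 1) * `|s - t|).
    by field; rewrite gt_eqF.
  by rewrite ler_wpM2l// ltW.
apply: le_trans (dotv_norm_le _ _) _.
apply: le_trans (ler_wpM2r (norm1_ge0 _) h2) _.
have -> : e / 2 * `|s - t| = e / (2 * (norm1 g + 1)) * `|s - t| * (norm1 g + 1).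
  by field; rewrite gt_eqF.
by rewrite ler_wpM2l ?lerDl// mulr_ge0// ltW.
Unshelve. all: by end_near.
Qed.

End CubeC1.

(** * Restriction to segments, and the l1 norm along them *)

Section segments.
Context {R : realType} {n : nat}.
Implicit Types (f F : 'rV[R]_n -> R) (x u : 'rV[R]_n).

Lemma cube_segment x u (s : R) : cube x -> cube (x + u) -> 0 <= s <= 1 ->
  cube (x + s *: u).
Proof.
move=> [x0 x1] [u0 u1] s01.
have C i : 0 <= x 0 i + s * u 0 i <= 1.
  move: (x0 i) (x1 i) (u0 i) (u1 i) s01; rewrite !mxE; nra.
by split => i; rewrite !mxE; have /andP[] := C i.
Qed.

Lemma is_derive_segment x u (s : R) :
  is_derive s (1 : R) (fun r => x + r *: u) u.
Proof.
apply/is_derive_nearP => e e0; near=> r.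
rewrite opprD addrACA subrr add0r -scalerBl subrr normr0.
by rewrite mulr_ge0// ltW.
Unshelve. all: by end_near.
Qed.

Lemma segment_continuous f x u : Ck_on_cube 1 f -> cube x -> cube (x + u) ->
  {within `[0 : R, 1], continuous (fun s => f (x + s *: u))}.
Proof.
move=> C1f cx cu; have [K K0 HK] := cube_lipschitz C1f.
apply/subspace_continuousP => s /=; rewrite in_itv/= => s01.
apply/cvgrPdist_le => e e0; pose L := K * `|u| + 1.
have L0 : 0 < L by rewrite ltr_wpDl// mulr_ge0.
apply/nbhs_ballP; exists (e / L); first by rewrite /= divr_gt0.
move=> t /=; rewrite /ball/= in_itv/= => st t01.
apply: le_trans (HK _ _ (cube_segment cx cu t01) (cube_segment cx cu s01)) _.
rewrite opprD addrACA subrr add0r -scalerBl normrZ.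
apply: (@le_trans _ _ (L * (e / L))); last by rewrite mulrC divfK// gt_eqF.
rewrite mulrCA mulrC; apply: ler_pM => //; first by rewrite mulr_ge0.
  by rewrite /L lerDl.
exact: ltW.
Qed.

Lemma segment_is_derive f x u (s : R) : Ck_on_cube 1 f ->
  cube x -> cube (x + u) -> 0 < s < 1 ->
  is_derive s (1 : R) (fun r => f (x + r *: u)) (dotv u (grad f (x + s *: u))).
Proof.
move=> C1f cx cu /andP[s0 s1].
apply: (@is_derive_cube_comp _ _ f (fun r => x + r *: u)) => //; last first.
  exact: is_derive_segment.
apply: filterS (filterI (lt_nbhsr s0) (lt_nbhsl s1)) => r [r0 r1].
by apply: cube_segment; rewrite // !ltW.
Qed.

Lemma Ck_on_cube21 f : Ck_on_cube 2 f -> Ck_on_cube 1 f.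
Proof. by move=> [cf pf]; split=> // i; have [? []] := pf i. Qed.

Lemma segment_grad_continuous F x u : Ck_on_cube 2 F -> cube x -> cube (x + u) ->
  {within `[0 : R, 1], continuous (fun s => dotv u (grad F (x + s *: u)))}.
Proof.
move=> C2F cx cu.
have -> : (fun s => dotv u (grad F (x + s *: u))) =
    (fun s : R => \sum_j u 0 j * partial j F (x + s *: u)).
  by apply/funext => s; apply: eq_bigr => j _; rewrite mxE.
apply: continuous_big => [|j _ s]; first exact: add_continuous.
apply: cvgM; first exact: cvg_cst.
exact: (segment_continuous (C2F.2 j).2 cx cu).
Qed.

(** Each partial derivative is itself C1 on the cube, so the first-order rule applies to every
    [partial j F]; the weighted sum over [j] is the Hessian quadratic form. *)
Lemma segment_grad_is_derive F x u (s : R) : Ck_on_cube 2 F ->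
  cube x -> cube (x + u) -> 0 < s < 1 ->
  is_derive s (1 : R) (fun r => dotv u (grad F (x + r *: u)))
    ((u *m hess F (x + s *: u) *m u^T) 0 0).
Proof.
move=> C2F cx cu s01.
have -> : (fun r => dotv u (grad F (x + r *: u))) =
    \sum_j u 0 j *: (fun r : R => partial j F (x + r *: u)).
  apply/funext => r; rewrite fct_sumE; apply: eq_bigr => j _.
  by rewrite mxE.
have -> : (u *m hess F (x + s *: u) *m u^T) 0 0 =
    \sum_j u 0 j *: dotv u (grad (partial j F) (x + s *: u)).
  rewrite mxE; apply: eq_bigr => j _; rewrite !mxE mulrC; congr (_ * _).
  by apply: eq_bigr => i _; rewrite !mxE.
apply: is_derive_sum => j; apply: is_deriveZ.
exact: segment_is_derive (C2F.2 j).2 cx cu s01.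
Qed.

Lemma norm1_vle0 x : vle 0 x -> norm1 x = \sum_i x 0 i.
Proof.
by move=> x0; apply: eq_bigr => i _; rewrite ger0_norm//; have := x0 i; rewrite mxE.
Qed.

Lemma vle0_segment x u (s : R) : vle 0 x -> vle 0 u -> 0 <= s -> vle 0 (x + s *: u).
Proof.
move=> x0 u0 s0 i; move: (x0 i) (u0 i); rewrite !mxE => ? ?.
by rewrite addr_ge0// mulr_ge0.
Qed.

Lemma norm1_segment x u (s : R) : vle 0 x -> vle 0 u -> 0 <= s ->
  norm1 (x + s *: u) = norm1 x + s * norm1 u.
Proof.
move=> x0 u0 s0; rewrite !norm1_vle0//; last exact: vle0_segment.
by rewrite mulr_sumr -big_split/=; apply: eq_bigr => i _; rewrite !mxE.
Qed.

Lemma norm1_eq0 x : norm1 x = 0 -> x = 0.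
Proof.
move/eqP; rewrite psumr_eq0// => /allP H; apply/rowP => i; rewrite mxE.
by apply/eqP; rewrite -normr_eq0; apply: (implyP (H i _)); rewrite ?mem_index_enum.
Qed.

End segments.

(** * One-variable differential inequalities *)

Lemma le0_derive_le01 {R : realType} (g g' : R -> R) (s : R) :
  {within `[0 : R, 1], continuous g} ->
  (forall s : R, 0 < s < 1 -> is_derive s (1 : R) g (g' s)) ->
  (forall s : R, 0 < s < 1 -> g' s <= 0) ->
  0 <= s <= 1 -> g s <= g 0.
Proof.
move=> cg dg g'0 /andP[s0 s1]; apply: (@ler0_derive1_nincr R g 0 1) => //.
  by move=> t; rewrite in_itv/= => t01; have [] := dg t t01.
move=> t; rewrite in_itv/= => t01; have [_ dv] := dg t t01.
by rewrite derive1E dv g'0.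
Qed.

(* Multiplying [g] by [(r + s)^(-p)] turns the differential inequality into
   monotonicity; at [r = 0] this only makes sense for [p = 0]. *)
Lemma power_growth {R : realType} (g g' : R -> R) (p r alpha M s : R) :
  0 <= p -> 0 <= alpha <= r -> 0 <= M ->
  {within `[0 : R, 1], continuous g} ->
  (forall s : R, 0 < s < 1 -> is_derive s (1 : R) g (g' s)) ->
  (forall s : R, 0 < s < 1 -> g' s <= p / (r + s) * g s) ->
  g 0 <= M -> 0 <= s <= 1 -> (alpha / (alpha + 1)) `^ p * g s <= M.
Proof.
move=> p0 /andP[a0 ar] M0 cg dg ineq g0M s01.
have [gs0|gs0] := leP (g s) 0.
  by apply: le_trans M0; rewrite mulr_ge0_le0// powR_ge0.
have [r0|r0] := leP r 0.
  (* Now [0] raised to [p] vanishes unless [p = 0], where it equals [1] and the inequality just says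
     that [g] is nonincreasing. *)
  have -> : alpha = 0 by lra.
  have [pE|pn0] := eqVneq p 0; last by rewrite mul0r powR0// mul0r.
  rewrite pE powRr0 mul1r; apply: le_trans g0M.
  apply: (le0_derive_le01 cg dg _ s01) => t t01.
  by apply: le_trans (ineq t t01) _; rewrite pE !mul0r.
pose E (t : R) := expR (- p * ln (r + t)).
have dE (t : R) : 0 <= t -> is_derive t (1 : R) E (E t * (- p * (r + t)^-1)).
  move=> t0; have rt : 0 < r + t by lra.
  have dl : is_derive t (1 : R) (fun t => ln (r + t)) ((r + t)^-1 * 1).
    have d1 : is_derive t (1 : R) (fun t => r + t) 1.
      rewrite -[X in is_derive _ _ _ X]add0r.
      exact: (is_deriveD (is_derive_cst _ _ _) (is_derive_id _ _)).
    exact: (@is_derive1_comp _ (@ln R) _ _ _ _ (is_derive1_ln rt) d1).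
  have dpl : is_derive t (1 : R) (fun t => - p * ln (r + t)) (- p * (r + t)^-1).
    by rewrite -[(r + t)^-1]mulr1; exact: is_deriveZ.
  exact: (@is_derive1_comp _ expR).
have cE : {within `[0 : R, 1], continuous E}.
  apply: derivable_within_continuous => t; rewrite in_itv/= => /andP[t0 _].
  by have [] := dE t t0.
have cgE : {within `[0 : R, 1], continuous (g \* E)}.
  by move=> t; apply: cvgM; [exact: cg|exact: cE].
have dgE (t : R) : 0 < t < 1 -> is_derive t (1 : R) (g \* E)
    (g t * (E t * (- p * (r + t)^-1)) + E t * g' t).
  by move=> t01; apply: is_deriveM; [exact: dg|apply: dE; case/andP: t01 => /ltW].
have E0 t : 0 < E t by exact: expR_gt0.
have gE : (g \* E) s <= (g \* E) 0.
  apply: (le0_derive_le01 cgE dgE _ s01) => t t01; have := ineq t t01; have := E0 t => Et h.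
  have -> : g t * (E t * (- p * (r + t)^-1)) + E t * g' t =
    E t * (g' t - p / (r + t) * g t) by ring.
  by rewrite pmulr_rle0// subr_le0.
move: gE; rewrite /= => gE.
have [s0 s1] := andP s01.
have rs : 0 < r + s by lra.
(* [E s / E 0] is the [p]-th power of [r / (r + s)], which dominates [alpha / (alpha + 1)] because
   [alpha * s <= r]. *)
have kE : (alpha / (alpha + 1)) `^ p <= E s / E 0.
  have -> : E s / E 0 = (r / (r + s)) `^ p.
    rewrite /powR gt_eqF ?divr_gt0// /E addr0 -expRN -expRD ln_div// mulrBr.
    by congr expR; ring.
  apply: ge0_ler_powR; rewrite ?nnegrE//.
  - by rewrite divr_ge0// addr_ge0.
  - by rewrite divr_ge0// ltW.
  rewrite ler_pdivrMr ?ltr_wpDl// mulrAC ler_pdivlMr//; nra.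
apply: le_trans g0M; apply: (@le_trans _ _ (E s / E 0 * g s)).
  by rewrite ler_wpM2r// ltW.
by rewrite mulrAC ler_pdivrMr// mulrC.
Qed.

Lemma ae_lebesgueS {R : realType} (P Q : R -> Prop) :
  (forall t, P t -> Q t) ->
  {ae lebesgue_measure, forall t : R, P t} ->
  {ae lebesgue_measure, forall t : R, Q t}.
Proof.
move=> PQ [N [mN N0 HN]]; exists N; split=> // t nQ.
by apply: HN => /PQ.
Qed.

(** * Gain of the greedy direction at a point of the cube *)

Section greedy.
Context {R : realType} {n : nat}.
Implicit Types (F : 'rV[R]_n -> R) (P : set 'rV[R]_n) (x u v : 'rV[R]_n).

(* The direction is [u = (x \/ xopt) - x]: it lies in [P] because it is dominated
   by [xopt], and [x + u] stays in the cube, which [x + xopt] need not do. *)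
Lemma greedy_gain F P (sigma alpha : R) (vstar v x xopt : 'rV[R]_n) :
  0 <= sigma -> monotone_on_cube F -> one_sided_smooth sigma F -> 0 <= alpha ->
  P `<=` cube -> downward_closed P -> argmax P norm1 vstar ->
  argmax P (fun v => dotv v (grad F x)) v -> cube x ->
  alpha * norm1 vstar <= norm1 x -> P xopt ->
  (alpha / (alpha + 1)) `^ (2 * sigma) * (F xopt - F x) <= dotv v (grad F x).
Proof.
move=> sg0 mF [C2F smooth] al0 Pcube Pdown [Pvs vsmax] [Pv vmax] cx nx Po.
have [x0 x1] := cx.
have [q0 q1] := Pcube _ Po.
pose u : 'rV[R]_n := \row_i Num.max 0 (xopt 0 i - x 0 i).
have u0 : vle 0 u by move=> i; rewrite !mxE le_max lexx.
have uo : vle u xopt.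
  move=> i; rewrite !mxE ge_max; move: (q0 i) (x0 i); rewrite !mxE => -> ?.
  by rewrite lerBlDr lerDl.
have Pu : P u := Pdown _ _ Po u0 uo.
have cu : cube (x + u).
  split => i; move: (x0 i) (x1 i) (q1 i); rewrite !mxE => h1 h2 h3.
    by rewrite addr_ge0// le_max lexx.
  by rewrite -lerBrDl ge_max subr_ge0 h2 lerB.
have Fo : F xopt <= F (x + u).
  by apply: mF => // i; rewrite !mxE -lerBlDl le_max lexx orbT.
have M0 : 0 <= dotv v (grad F x).
  have P0 : P 0 by apply: Pdown Pu _ u0 => i.
  by apply: le_trans (vmax _ P0); rewrite /dotv big1// => i _; rewrite mxE mul0r.
set kappa := _ `^ _.
have k0 : 0 <= kappa by exact: powR_ge0.
apply: (@le_trans _ _ (kappa * (F (x + u) - F x))).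
  by rewrite ler_wpM2l// lerD2r.
have [uE|un0] := eqVneq u 0; first by rewrite uE addr0 subrr mulr0.
have N0 : 0 < norm1 u.
  rewrite lt_neqAle norm1_ge0 andbT eq_sym; apply: contra un0 => /eqP/norm1_eq0 ->.
  exact: eqxx.
(* The mean value theorem plays the role of integration: the increment of [F] equals the directional
   derivative at one [c], where [power_growth] is applied. *)
have [|||c] := @MVT_segment _ (fun s => F (x + s *: u))
    (fun s => dotv u (grad F (x + s *: u))) 0 1.
- exact: ler01.
- move=> s; rewrite in_itv/=; exact: segment_is_derive (Ck_on_cube21 C2F) cx cu.
- exact: segment_continuous (Ck_on_cube21 C2F) cx cu.
rewrite in_itv/= subr0 mulr1 scale1r scale0r addr0 => c01 ->.
(* By additivity of the l1 norm on nonnegative vectors, [norm1 (x + s *: u)] is [norm1 u * (r + s)].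
   Since [u] is in [P], its norm is at most that of [vstar], whence [alpha <= r]. *)
pose r := norm1 x / norm1 u.
apply: (@power_growth _ (fun s => dotv u (grad F (x + s *: u)))
   (fun s => (u *m hess F (x + s *: u) *m u^T) 0 0) (2 * sigma) r) => //.
- by rewrite mulr_ge0.
- rewrite al0 ler_pdivlMr//; apply: le_trans nx; rewrite ler_wpM2l//.
  exact: vsmax.
- exact: segment_grad_continuous.
- by move=> s; exact: segment_grad_is_derive.
- move=> s /andP[s0 s1].
  have ns : norm1 (x + s *: u) = norm1 x + s * norm1 u.
    by rewrite norm1_segment// ltW.
  (* Here [0 < s] matters: [x] itself may be the origin, where smoothness says nothing. *)
  have ns0 : 0 < norm1 (x + s *: u).
    by rewrite ns ltr_wpDl// ?norm1_ge0// mulr_gt0.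
  have y0 : x + s *: u != 0.
    apply: contraTneq ns0 => ->; rewrite /norm1 big1 ?ltxx// => i _.
    by rewrite mxE normr0.
  have cs : cube (x + s *: u) by apply: cube_segment => //; rewrite !ltW.
  have := smooth u _ u0 cs y0; rewrite ns.
  have -> : 2 * sigma / (r + s) = 2 * (sigma * (norm1 u / (norm1 x + s * norm1 u))).
    rewrite /r; field; rewrite ns in ns0; rewrite (gt_eqF ns0) (gt_eqF N0)/=.
    by [].
  lra.
- by rewrite scale0r addr0; exact: vmax.
Qed.

(** * Integrating almost everywhere bounds along the trajectory *)

Lemma is_derive_dotv (x : R -> 'rV[R]_n) (a d : 'rV[R]_n) (t : R) :
  is_derive t (1 : R) x d -> is_derive t (1 : R) (fun s => dotv (x s) a) (dotv d a).
Proof.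
move=> /is_derive_nearP dx; apply/is_derive_nearP => e e0.
have G0 : 0 < norm1 a + 1 by rewrite ltr_wpDl// norm1_ge0.
have := dx _ (divr_gt0 e0 G0); apply: filterS => s hs.
rewrite -dotvBl /GRing.scale/= -dotvZl -dotvBl.
apply: le_trans (dotv_norm_le _ _) _.
apply: le_trans (ler_wpM2r (norm1_ge0 _) hs) _.
rewrite mulrAC ler_wpM2r// mulrAC ler_pdivrMr// ler_wpM2l ?lerDl//.
exact: ltW.
Qed.

(** The function [dotv (x t) a - c * t] has nonnegative derivative almost everywhere. It serves for
    the linear constraints of [P], and for the l1 norm with [a] the all-ones vector. *)
Lemma ae_derive_dotv_le (x d : R -> 'rV[R]_n) (a : 'rV[R]_n) (c T : R) :
  0 <= T <= 1 -> abs_continuous 0 1 x ->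
  {ae lebesgue_measure, forall t : R, 0 < t < 1 -> is_derive t (1 : R) x (d t)} ->
  (forall t, 0 < t < 1 -> c <= dotv (d t) a) ->
  c * T <= dotv (x T) a - dotv (x 0) a.
Proof.
move=> /andP[T0 T1] acx dx cd.
have h : dotv (x 0) a - c * 0 <= dotv (x T) a - c * T; last by lra.
apply: (@ge0_ae_derive_le _ 0 T (fun t => dotv (x t) a - c * t)) => //.
  apply: (@abs_continuous_dom _ _ _ 0 T (norm1 a + `|c|) x).
  - by rewrite addr_ge0// norm1_ge0.
  - move=> l r l0 lr rT.
    have -> : dotv (x r) a - c * r - (dotv (x l) a - c * l) =
      dotv (x r - x l) a - c * (r - l) by rewrite dotvBl; ring.
    apply: le_trans (ler_normB _ _) _.
    have := dotv_norm_le (x r - x l) a; rewrite normrM (@ger0_norm _ (r - l)) ?subr_ge0//.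
    have p1 : 0 <= norm1 a * (r - l) by rewrite mulr_ge0 ?norm1_ge0 ?subr_ge0.
    have p2 : 0 <= `|c| * `|x r - x l| by rewrite mulr_ge0.
    lra.
  - exact: abs_continuous_sub acx.
apply: ae_lebesgueS dx => t dxt /andP[t0 tT].
have t01 : 0 < t < 1 by rewrite t0 (lt_le_trans tT).
exists (dotv (d t) a - c); first by rewrite subr_ge0 cd.
apply: is_deriveB; first exact: is_derive_dotv (dxt t01).
by rewrite -[X in is_derive _ _ _ X]mulr1; exact: (is_deriveZ _ (is_derive_id _ _)).
Qed.

End greedy.

(* Gronwall's argument: [exp(c t) (F (x t) - m)] is nondecreasing. *)
Lemma ae_gronwall {R : realType} {n : nat} (F : 'rV[R]_n -> R)
    (x d : R -> 'rV[R]_n) (c m : R) :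
  Ck_on_cube 1 F -> 0 <= c -> (forall t, 0 <= t <= 1 -> cube (x t)) ->
  abs_continuous 0 1 x ->
  {ae lebesgue_measure, forall t : R, 0 < t < 1 -> is_derive t (1 : R) x (d t)} ->
  (forall t, 0 < t < 1 -> c * (m - F (x t)) <= dotv (d t) (grad F (x t))) ->
  F (x 0) - m <= expR c * (F (x 1) - m).
Proof.
move=> C1F c0 cx acx dx ineq.
have [K K0 HK] := cube_lipschitz C1F.
pose h := (expR \o *%R c) \* (fun t => F (x t) - m).
suff : h 0 <= h 1 by rewrite /h/= mulr0 expR0 mul1r mulr1.
have [B B0 HB] : exists2 B : R, 0 <= B & forall t, 0 <= t <= 1 -> `|F (x t) - m| <= B.
  have [M [_ HM]] := compact_bounded (continuous_compact C1F.1 cube_compact).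
  exists (`|M| + 1 + `|m|); first by rewrite !addr_ge0.
  move=> t /cx ct; apply: le_trans (ler_normB _ _) _; rewrite lerD2r.
  by apply: HM; [rewrite (le_lt_trans (ler_norm M))// ltrDl|exists (x t)].
apply: ge0_ae_derive_le => //.
  apply: (@abs_continuous_dom _ _ _ 0 1 (expR c * (K + c * B)) x) => //.
    by rewrite mulr_ge0 ?expR_ge0// addr_ge0// mulr_ge0.
  move=> l r l0 lr r1.
  have l01 : 0 <= l <= 1 by rewrite l0 (le_trans lr).
  have r01 : 0 <= r <= 1 by rewrite r1 (le_trans l0).
  have er : expR (c * r) <= expR c by rewrite ler_expR ler_piMr.
  (* This form bounds the increment by those of [F] along [x] and of time, through
     [1 - exp(-y) <= y]; hence [h] is absolutely continuous. *)
  have -> : h r - h l = expR (c * r) * ((F (x r) - F (x l)) +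
      (1 - expR (- (c * (r - l)))) * (F (x l) - m)).
    have -> : - (c * (r - l)) = c * l - c * r by ring.
    by rewrite expRB /h/=; field; rewrite gt_eqF// expR_gt0.
  rewrite normrM (ger0_norm (expR_ge0 _)) -mulrA.
  apply: ler_pM; rewrite ?expR_ge0//.
  apply: le_trans (ler_normD _ _) _.
  have rl : 0 <= r - l by rewrite subr_ge0.
  have crl : 0 <= c * (r - l) by rewrite mulr_ge0.
  have h1 := HK _ _ (cx _ l01) (cx _ r01).
  have h2 : `|(1 - expR (- (c * (r - l)))) * (F (x l) - m)| <= c * (r - l) * B.
    rewrite normrM; apply: ler_pM => //; last exact: HB.
    rewrite ger0_norm; last by rewrite subr_ge0 -expR0 ler_expR oppr_le0.
    by have := expR_ge1Dx (- (c * (r - l))); lra.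
  have h3 : 0 <= K * (r - l) by rewrite mulr_ge0.
  have h4 : 0 <= c * B * `|x r - x l| by rewrite !mulr_ge0.
  lra.
apply: ae_lebesgueS dx => t dxt t01.
have [t0 t1] := andP t01.
exists (expR (c * t) * dotv (d t) (grad F (x t)) + (F (x t) - m) * (expR (c * t) * c)).
  have -> : expR (c * t) * dotv (d t) (grad F (x t)) + (F (x t) - m) * (expR (c * t) * c)
    = expR (c * t) * (dotv (d t) (grad F (x t)) - c * (m - F (x t))) by ring.
  by rewrite mulr_ge0 ?expR_ge0// subr_ge0 ineq.
apply: is_deriveM.
  apply: (@is_derive1_comp _ expR); rewrite -[X in is_derive _ _ _ X]mulr1.
  exact: (is_deriveZ _ (is_derive_id _ _)).
rewrite -[X in is_derive _ _ _ X]subr0.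
apply: (@is_deriveB _ _ _ (F \o x) (cst m)).
apply: is_derive_cube_comp => //; last exact: dxt.
apply: filterS (filterI (lt_nbhsr t0) (lt_nbhsl t1)) => s [s0 s1].
by apply: cx; rewrite !ltW.
Qed.
Unset Implicit Arguments.

(** * Feasibility of the endpoint and the approximation guarantee *)

Theorem theorem1 (R : realType) (n : nat) (sigma alpha : R)
    (F : 'rV[R]_n -> R) (P : set 'rV[R]_n)
    (vstar : 'rV[R]_n) (vmax : 'rV[R]_n -> 'rV[R]_n) (x : R -> 'rV[R]_n)
    (OPT : R) :
  0 <= sigma ->
  (forall y, cube y -> 0 <= F y) ->
  monotone_on_cube F ->
  one_sided_smooth sigma F ->
  0 <= alpha < 1 ->
  P `<=` cube ->
  polytope P ->
  downward_closed P ->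
  jump_start_trajectory F P alpha vstar vmax x ->
  is_maximum (F @` P) OPT ->
  P (x 1) /\
  F (x 1) >=
    (1 - expR (- ((1 - alpha) * (alpha / (alpha + 1)) `^ (2 * sigma)))) * OPT.
Proof.
move=> sg0 F0 mF smooth /andP[a0 a1] Pcube [[m [A [b PE]]] _] Pdown
  [vstarmax vmaxP [x0 cx acx dx]] [[xopt Pxopt FoE] _].
have [Pvs _] := vstarmax.
have a1' : 0 <= 1 - alpha by rewrite subr_ge0 ltW.
have Pvmax t : 0 <= t <= 1 -> P (vmax (x t)) by move=> /cx/vmaxP[].
split.
  have dotA y k : (A *m y^T) k 0 = dotv y (row k A).
    by rewrite mxE; apply: eq_bigr => i _; rewrite !mxE mulrC.
  have PA y k : P y -> dotv y (row k A) <= b k 0.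
    by rewrite PE => /(_ k); rewrite dotA.
  rewrite PE => k; rewrite dotA.
  (* [ae_derive_dotv_le] gives lower bounds, so the constraint row is negated; the start contributes
     [alpha * b] and the motion [(1 - alpha) * b]. *)
  have dotN y : dotv y (- row k A) = - dotv y (row k A).
    by rewrite -sumrN; apply: eq_bigr => i _; rewrite !mxE mulrN.
  have T1 : 0 <= (1 : R) <= 1 by rewrite ler01 lexx.
  have slope (t : R) : 0 < t < 1 ->
      - ((1 - alpha) * b k 0) <= dotv ((1 - alpha) *: vmax (x t)) (- row k A).
    move=> /andP[t0 t1]; rewrite dotN dotvZl lerN2 ler_wpM2l//.
    by apply: PA; apply: Pvmax; rewrite !ltW.
  have := ae_derive_dotv_le T1 acx dx slope.
  rewrite !dotN x0 dotvZl; have := ler_wpM2l a0 (PA _ k Pvs); lra.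
have gain t : 0 < t < 1 ->
    (alpha / (alpha + 1)) `^ (2 * sigma) * (OPT - F (x t)) <=
      dotv (vmax (x t)) (grad F (x t)).
  move=> /andP[t0 t1]; have t01 : 0 <= t <= 1 by rewrite !ltW.
  have ct := cx _ t01; rewrite -FoE.
  apply: (greedy_gain sg0 mF smooth a0 Pcube Pdown vstarmax (vmaxP _ ct) ct _ Pxopt).
  (* On the cube the l1 norm is linear, and the velocity is nonnegative, so the norm never drops
     below its initial value [alpha * norm1 vstar]. *)
  have dot1 y : cube y -> norm1 y = dotv y (const_mx 1).
    by move=> [y0 _]; rewrite norm1_vle0//; apply: eq_bigr => i _; rewrite mxE mulr1.
  have slope (s : R) : 0 < s < 1 ->
      0 <= dotv ((1 - alpha) *: vmax (x s)) (const_mx 1).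
    move=> /andP[s0 s1]; rewrite dotvZl mulr_ge0// -dot1 ?norm1_ge0//.
    by apply/Pcube/Pvmax; rewrite !ltW.
  have := ae_derive_dotv_le t01 acx dx slope.
  by rewrite mul0r subr_ge0 x0 dotvZl -!dot1//; exact: Pcube.
set kappa := _ `^ _ in gain *; set c := (1 - alpha) * kappa.
have c0 : 0 <= c by rewrite mulr_ge0// powR_ge0.
have slope (t : R) : 0 < t < 1 ->
    c * (OPT - F (x t)) <= dotv ((1 - alpha) *: vmax (x t)) (grad F (x t)).
  by move=> t01; rewrite dotvZl -mulrA ler_wpM2l// gain.
have := ae_gronwall (Ck_on_cube21 smooth.1) c0 cx acx dx slope.
have Fx0 : 0 <= F (x 0) by apply: F0; apply: cx; rewrite lexx ler01.
move=> h.
have : expR (- c) * (F (x 0) - OPT) <= F (x 1) - OPT.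
  rewrite -(ler_pM2l (expR_gt0 c)); apply: le_trans h.
  by rewrite mulrA -expRD subrr expR0 mul1r.
(* Nonnegativity of [F] at the start lets this term be dropped, leaving the factor [1 - exp(-c)] on
   [OPT]. *)
have : 0 <= expR (- c) * F (x 0) by rewrite mulr_ge0// expR_ge0.
lra.
Qed.
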